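(* Let $n\ge 1$, let $E_{\mathrm{in}}=\mathbb{S}^{n-1}\subset\mathbb{R}^n$ be the unit sphere, let $A$ be a real symmetric positive definite $n\times n$ matrix, and let $E_{\mathrm{out}}=A^{-1}E_{\mathrm{in}}$, an ellipsoid centered at the origin. Assume that $E_{\mathrm{in}}$ and $E_{\mathrm{out}}$ are disjoint and $E_{\mathrm{in}}\subset\operatorname{conv}(E_{\mathrm{out}})$. Let $\mathcal{C}_t(E_{\mathrm{in}},E_{\mathrm{out}})$ be the set of all labeled centrally symmetric cross polytopes fitting tightly between $E_{\mathrm{out}}$ and $E_{\mathrm{in}}$. Then $\mathcal{C}_t(E_{\mathrm{in}},E_{\mathrm{out}})$ is nonempty if and only if $\operatorname{tr}(A^2)=1$. In this case, the map $\phi:\mathcal{C}_t(E_{\mathrm{in}},E_{\mathrm{out}})\to O(n)$, taking a cross polytope with labeled vertices $\pm v_1,\ldots,\pm v_n$ to the matrix $Q\in O(n)$ with $Qe_k=v_k/|v_k|$ for $1\le k\le n$, is a diffeomorphism.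
   Context: $\operatorname{conv}$ denotes convex hull, $O(n)$ the real orthogonal group, $(e_k)$ the canonical basis of $\mathbb{R}^n$. A centrally symmetric cross polytope in $\mathbb{R}^n$ is a convex polytope with nonempty interior and vertices $\pm v_1,\ldots,\pm v_n$ (so $v_1,\dots,v_n$ is a basis). A label for it is such a family $(v_k)_{1\le k\le n}$; a labeled cross polytope is one together with a label, so that the set of labeled cross polytopes is regarded as a subset of $(\mathbb{R}^n)^n$. A closed convex polytope $P\subset\mathbb{R}^n$ fits between $E_{\mathrm{out}}$ and $E_{\mathrm{in}}$ if $E_{\mathrm{in}}\subset P\subset\operatorname{conv}(E_{\mathrm{out}})$. It is inscribed in $E_{\mathrm{out}}$ if all its vertices belong to $E_{\mathrm{out}}$, and circumscribed to $E_{\mathrm{in}}$ if all its hyperfaces (facets) are tangent to $E_{\mathrm{in}}$. It fits tightly if it fits, is inscribed in $E_{\mathrm{out}}$ and is circumscribed to $E_{\mathrm{in}}$. ''Diffeomorphism'' means a bijection which is smooth with smooth inverse, where $\mathcal{C}_t(E_{\mathrm{in}},E_{\mathrm{out}})$ is viewed inside $(\mathbb{R}^n)^n$ via labels. *)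

(* Defs.v *)
From mathcomp Require Import all_boot all_order all_algebra.
From mathcomp Require Import all_classical all_reals all_analysis.

Set Implicit Arguments.
Unset Strict Implicit.
Unset Printing Implicit Defensive.

Import Order.TTheory GRing.Theory Num.Theory.
Import numFieldNormedType.Exports.

Local Open Scope classical_set_scope.
Local Open Scope ring_scope.

Section EuclideanSpace.
Context {R : realType} {n : nat}.
Implicit Types (x y u : 'cV[R]_n) (A : 'M[R]_n).

Definition dotv x y : R := \sum_i x i 0 * y i 0.

(* The library norm [`|x|] on matrices is the sup norm, not the Euclidean one. *)
Definition enorm x : R := Num.sqrt (dotv x x).

Definition unit_sphere : set 'cV[R]_n := [set x | enorm x = 1].

Definition sym_posdef A : Prop :=
  A^T = A /\ forall x, x != 0 -> 0 < dotv x (A *m x).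

Definition orthogonal_group : set 'M[R]_n := [set Q | Q^T *m Q = 1%:M].

Definition conv_hull (S : set 'cV[R]_n) : set 'cV[R]_n :=
  smallest (@convex_set R 'cV[R]_n) S.

End EuclideanSpace.

Section Polytopes.
Context {R : realType} {n : nat}.
Implicit Types (P F S : set 'cV[R]_n) (x u : 'cV[R]_n).

Definition polytope P : Prop :=
  exists S, finite_set S /\ P = conv_hull S.

Definition face P F : Prop :=
  exists u (c : R), (forall y, P y -> dotv u y <= c) /\
    F = P `&` [set y | dotv u y = c].

(* [U] is the linear span of [F - x0], so that [x0 + U] is the affine hull
   of [F]. *)
Definition has_dim F (d : nat) : Prop :=
  exists x0 (U : {vspace 'cV[R]_n}),
    [/\ F x0, \dim U = d &
        forall W : {vspace 'cV[R]_n},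
          (U <= W)%VS <-> (forall y, F y -> y - x0 \in W)].

Definition vertex P x : Prop := face P [set x].

Definition facet P F : Prop := face P F /\ has_dim F n.-1.

Definition sphere_tangent_hyperplane x : set 'cV[R]_n :=
  [set y | dotv x (y - x) = 0].

(* For a facet [F], which spans a hyperplane, the inclusion says that the
   affine hull of [F] is the tangent hyperplane at the contact point [x]. *)
Definition tangent_to_sphere F : Prop :=
  exists x, [/\ unit_sphere x, F x & F `<=` sphere_tangent_hyperplane x].

Definition fits_between P Ein Eout : Prop :=
  Ein `<=` P /\ P `<=` conv_hull Eout.

Definition inscribed P Eout : Prop :=
  forall x, vertex P x -> Eout x.

Definition circumscribed_to_sphere P : Prop :=
  forall F, facet P F -> tangent_to_sphere F.

Definition fits_tightly_sphere P Eout : Prop :=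
  [/\ fits_between P unit_sphere Eout, inscribed P Eout
    & circumscribed_to_sphere P].

(* A family [(v_k)] in [(R^n)^n] is encoded as the matrix whose [k]-th column
   is [v_k]. *)
Definition labeled_cross_polytope P (V : 'M[R]_n) : Prop :=
  [/\ polytope P, interior P !=set0 &
      [set x | vertex P x] =
      [set x | exists k, x = col k V \/ x = - col k V]].

(* A labeled cross polytope is identified with its label, since the polytope is
   the convex hull of its vertices. *)
Definition tight_cross_polytopes Eout : set 'M[R]_n :=
  [set V | exists P, labeled_cross_polytope P V /\ fits_tightly_sphere P Eout].

Definition normalize_columns (V : 'M[R]_n) : 'M[R]_n :=
  \matrix_(i, k) (V i k / enorm (col k V)).

End Polytopes.

Section Smoothness.
Context {R : realType} {V W : normedModType R}.

(* On an open set of a finite-dimensional space, C^(k+1) means differentiable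
   with all directional derivatives C^k. *)
Fixpoint Ck_on (k : nat) (U : set V) (f : V -> W) : Prop :=
  match k with
  | 0 => forall x, U x -> {for x, continuous f}
  | k'.+1 => (forall x, U x -> differentiable f x) /\
             (forall v, Ck_on k' U ('D_v f))
  end.

Definition smooth_on (U : set V) (f : V -> W) : Prop :=
  forall k, Ck_on k U f.

(* Smoothness of a map defined on an arbitrary subset: local extendability to
   a smooth map on an open set of the ambient space. *)
Definition smooth_map (S : set V) (f : V -> W) : Prop :=
  forall x, S x -> exists (U : set V) (g : V -> W),
    [/\ open U, U x, smooth_on U g & forall y, (S `&` U) y -> f y = g y].

End Smoothness.

Definition diffeomorphism {R : realType} {V W : normedModType R}
    (S : set V) (T : set W) (f : V -> W) : Prop :=
  [/\ set_bij S T f, smooth_map S f &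
      exists g : W -> V, (forall x, S x -> g (f x) = x) /\ smooth_map T g].

(* Main.v *)
(* Let [W] be the inverse transpose of [V], with columns [w_k] dual to the
   vertices [v_k].  The facets of the cross polytope lie in the hyperplanes
   [<x, y> = 1] where [<x, v_k> = s_k] with signs [s_k], that is
   [x = \sum_k s_k w_k], and such a facet is tangent to the unit sphere iff [x]
   is a unit vector lying in it.  All [2^n] signed sums of the [w_k] have norm 1
   iff the [w_k], equivalently the [v_k], are pairwise orthogonal and
   [\sum_k |w_k|^2 = \sum_k |v_k|^-2 = 1].  When moreover [|A v_k| = 1], the unit
   vectors [q_k = v_k / |v_k|] form an orthogonal matrix [Q] with
   [|v_k| = |A q_k|^-1], whence [\tr A^2 = \sum_k |A q_k|^2 = 1].  Conversely
   [Q |-> (q_k / |A q_k|)_k] is the inverse of the normalization map, and both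
   maps have the form [V |-> (v_k / |B v_k|)_k], which is smooth where no
   [B v_k] vanishes. *)

From HB Require Import structures.
Require Import Defs.
From mathcomp Require Import all_boot all_order all_algebra.
From mathcomp Require Import all_classical all_reals all_analysis.
From mathcomp Require Import ring lra.

Set Implicit Arguments.
Unset Strict Implicit.
Unset Printing Implicit Defensive.

Import Order.TTheory GRing.Theory Num.Theory.
Import numFieldNormedType.Exports.
Local Open Scope classical_set_scope.
Local Open Scope ring_scope.

(** * Smoothness of column scaling *)

(** The differential of [f] at [a] also serves [g]: the remainders agree near 0, and [g a = f a]
    because [a] lies in each of its neighbourhoods. *)
Lemma near_eq_differentiable (R : numFieldType) (V W : normedModType R)
    (f g : V -> W) (a : V) :
  {near a, f =1 g} -> differentiable f a -> differentiable g a.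
Proof.
move=> fg df; have dfc : continuous ('d f a) by exact: diff_continuous.
have fg0 : \forall h \near (0 : V), f (h + a) = g (h + a).
  by move: (fg); rewrite [X in X -> _](near_shift 0)/= subr0.
have gd : g \o shift a = cst (g a) + 'd f a +o_ 0 id.
  apply/eqaddoP => e e0.
  have /eqaddoP/(_ _ e0) := diff_locally df.
  apply: filter_app; near=> h.
  by rewrite !fctE /= (nbhs_singleton fg) (near fg0).
apply/diff_locallyP; rewrite (diff_unique dfc gd); split=> //.
Unshelve. all: by end_near. Qed.

Section ColumnAlgebra.
Context {R : realType} {n : nat}.
Variable B : 'M[R]_n.
Implicit Types (V H : 'M[R]_n) (f g : 'M[R]_n -> R).

(* Stable under directional derivatives: for [r_k V = |B v_k|^-1] one has
   [D_H r_k = - r_k^3 <B v_k, B h_k>]. *)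
Inductive column_algebra : ('M[R]_n -> R) -> Prop :=
| column_algebra_cst c : column_algebra (cst c)
| column_algebra_coord i k : column_algebra (fun V => V i k)
| column_algebra_inv k : column_algebra (fun V => (enorm (B *m col k V))^-1)
| column_algebraD f g :
    column_algebra f -> column_algebra g -> column_algebra (f + g)
| column_algebraM f g :
    column_algebra f -> column_algebra g -> column_algebra (f * g).

(** No [B v_k] vanishes. The squared norm is used because it is polynomial in the entries and
    [Num.sqrt] is differentiable at its positive values. *)
Definition regular_columns : set 'M[R]_n :=
  [set V | forall k, 0 < dotv (B *m col k V) (B *m col k V)].

Definition closed_under_derivative f :=
  (forall V, regular_columns V -> differentiable f V) /\
  forall H, exists2 g, column_algebra g &
    forall V, regular_columns V -> 'D_H f V = g V.

Let cud_cst c : closed_under_derivative (cst c).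
Proof.
split=> [V _|H]; first exact: differentiable_cst.
exists (cst 0); first exact: column_algebra_cst.
by move=> V _; rewrite derive_cst.
Qed.

Lemma derive_coord i k H V : 'D_H (fun M : 'M[R]_n => M i k : R) V = H i k.
Proof.
have dW : derivable (@id 'M[R]_n) V H by exact: derivable_id.
by have := derive_mx dW; rewrite derive_id => {2}->; rewrite mxE.
Qed.

Let cud_coord i k : closed_under_derivative (fun V => V i k).
Proof.
split=> [V _|H]; first exact: differentiable_coord.
exists (cst (H i k)); first exact: column_algebra_cst.
by move=> V _; rewrite derive_coord.
Qed.

Let cudD f g : closed_under_derivative f -> closed_under_derivative g ->
  closed_under_derivative (f + g).
Proof.
move=> [df Df] [dg Dg]; split=> [V UV|H].
  by apply: differentiableD; [exact: df|exact: dg].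
have [f' Af' f'E] := Df H; have [g' Ag' g'E] := Dg H.
exists (f' + g'); first exact: column_algebraD.
move=> V UV; rewrite deriveD; first by rewrite f'E// g'E.
- exact/diff_derivable/df.
- exact/diff_derivable/dg.
Qed.

Let cudM f g : column_algebra f -> column_algebra g ->
  closed_under_derivative f -> closed_under_derivative g ->
  closed_under_derivative (f * g).
Proof.
move=> Af Ag [df Df] [dg Dg]; split=> [V UV|H].
  by apply: differentiableM; [exact: df|exact: dg].
have [f' Af' f'E] := Df H; have [g' Ag' g'E] := Dg H.
exists (f * g' + g * f').
  by apply: column_algebraD; apply: column_algebraM.
move=> V UV; rewrite deriveM; first by rewrite f'E// g'E.
- exact/diff_derivable/df.
- exact/diff_derivable/dg.
Qed.

(** Membership has to travel with the derivative property: the product rule [f * g' + g * f'] stays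
    in the algebra only if [f] and [g] themselves lie in it. *)
Let good f := column_algebra f /\ closed_under_derivative f.

Let good_sum m (f : 'I_m -> 'M[R]_n -> R) :
  (forall i, good (f i)) -> good (fun V => \sum_i f i V).
Proof.
move=> gf; rewrite -fct_sumE; elim/big_ind : _ => //.
- by split; [exact: column_algebra_cst|exact: cud_cst].
- by move=> g h [? ?] [? ?]; split; [exact: column_algebraD|exact: cudD].
Qed.

Let goodM f g : good f -> good g -> good (f * g).
Proof. by move=> [? ?] [? ?]; split; [exact: column_algebraM|exact: cudM]. Qed.

Let good_quad k : good (fun V => dotv (B *m col k V) (B *m col k V)).
Proof.
apply: good_sum => i.
suff gi : good (fun V => (B *m col k V) i 0) by exact: (goodM gi gi).
rewrite (_ : (fun V => _) = fun V => \sum_j (B i j * V j k)); last first.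
  by apply/funext => V; rewrite mxE; apply: eq_bigr => j _; rewrite mxE.
apply: good_sum => j; apply: (@goodM (cst (B i j)) (fun V => V j k)).
  by split; [exact: column_algebra_cst|exact: cud_cst].
by split; [exact: column_algebra_coord|exact: cud_coord].
Qed.

Let cud_inv k : closed_under_derivative (fun V => (enorm (B *m col k V))^-1).
Proof.
pose q V := dotv (B *m col k V) (B *m col k V).
have [Aq [dq Dq]] := good_quad k; rewrite -/q in Aq dq Dq.
pose s : 'M[R]_n -> R := Num.sqrt \o q.
have sqrt_diff V : regular_columns V -> differentiable (@Num.sqrt R) (q V).
  by move=> /(_ k) q0; apply/derivable1_diffP; case: (is_derive1_sqrt q0).
have ds V : regular_columns V -> differentiable s V.
  by move=> UV; apply: differentiable_comp; [exact: dq|exact: sqrt_diff].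
have s0 V : regular_columns V -> s V != 0.
  by move=> /(_ k) q0; rewrite gt_eqF// sqrtr_gt0.
split=> [V UV|H]; first exact: (differentiableV (ds _ UV) (s0 _ UV)).
have [q' Aq' q'E] := Dq H.
pose r V := (enorm (B *m col k V))^-1.
have Ar : column_algebra r by exact: column_algebra_inv.
(* With [r = q^(-1/2)], the chain rule gives [- q^(-3/2) q' / 2], that is [- r^3 q' / 2]. *)
exists (cst (- 2^-1) * (r * (r * r)) * q').
  apply: column_algebraM => //; apply: column_algebraM.
    exact: column_algebra_cst.
  by do 2! apply: column_algebraM => //.
move=> V UV.
have := @deriveV R 'M[R]_n s V H (s0 _ UV) (diff_derivable (ds _ UV)).
rewrite [X in X = _](_ : _ = 'D_H (fun V => (enorm (B *m col k V))^-1) V)//.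
move=> ->.
have -> : 'D_H s V = (2 * s V)^-1 * q' V.
  rewrite deriveE; last exact: ds.
  rewrite (diff_comp (dq _ UV) (sqrt_diff _ UV)) /=.
  rewrite diff1E; last exact: sqrt_diff.
  rewrite -q'E// (deriveE _ (dq _ UV)) derive1E derive_sqrt; last exact: UV.
  by rewrite /GRing.scale/= mulrC.
rewrite /GRing.scale/= !fctE /r -/(s V).
have := s0 _ UV.
rewrite (_ : enorm _ = s V)//.
move=> sV0; field.
by rewrite sV0.
Qed.

Lemma column_algebra_derivative f :
  column_algebra f -> closed_under_derivative f.
Proof.
elim=> [c|i k|k|g h _ cg _ ch|g h Ag cg Ah ch]; [exact: cud_cst
  |exact: cud_coord|exact: cud_inv|exact: cudD|exact: cudM].
Qed.

Lemma open_regular_columns : open regular_columns.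
Proof.
rewrite openE => V UV.
pose U k : set 'M[R]_n := [set M | 0 < dotv (B *m col k M) (B *m col k M)].
suff /(@filter_forall _ _ U _ (alias_nbhs_filter V)) :
  forall k, nbhs V (U k) by [].
move=> k.
have [_ [dq _]] := good_quad k.
have /(_ [set x | 0 < x]) := differentiable_continuous (dq _ UV); apply.
by apply: open_nbhs_nbhs; split; [exact: open_gt|exact: UV].
Qed.

Lemma column_algebra_smooth (F : 'M[R]_n -> 'M[R]_n) :
  (forall i j, column_algebra (fun V => F V i j)) ->
  smooth_on regular_columns F.
Proof.
move=> AF k.
(* A directional derivative of [F] is known to have entries in the algebra only on the regular
   columns, so the induction must allow maps that merely agree there with such an [F]. *)
suff: forall G, (forall V, regular_columns V -> G V = F V) ->
  Ck_on k regular_columns G by apply.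
have dmx (F' : 'M[R]_n -> 'M[R]_n) V :
    (forall i j, column_algebra (fun V => F' V i j)) ->
  regular_columns V -> differentiable F' V.
  move=> AF' UV; rewrite (_ : F' =
      \sum_i \sum_j (fun M => F' M i j *: delta_mx i j)); last first.
    apply/funext => M; rewrite [LHS]matrix_sum_delta fct_sumE.
    by apply: eq_bigr => i _; rewrite fct_sumE.
  apply: differentiable_sum => i; apply: differentiable_sum => j.
  apply: differentiableZl; exact: (column_algebra_derivative (AF' i j)).1.
elim: k F AF => [|k IHk] F AF G GF.
all: have nFG V (UV : regular_columns V) : {near V, F =1 G}
  by apply: filterS (open_nbhs_nbhs (conj open_regular_columns UV)) => M /GF.
all: have dG V (UV : regular_columns V) : differentiable G V
  by exact: near_eq_differentiable (nFG V UV) (dmx F V AF UV).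
  by move=> V UV; apply/differentiable_continuous/dG.
split=> // H.
have /choice[F' F'P] (ij : 'I_n * 'I_n) : exists g, column_algebra g /\
    forall V, regular_columns V -> 'D_H (fun V => F V ij.1 ij.2) V = g V.
  have [_ /(_ H)[g Ag gE]] := column_algebra_derivative (AF ij.1 ij.2).
  by exists g.
apply: (IHk (fun V => \matrix_(i, j) F' (i, j) V)) => [i j|V UV].
  rewrite (_ : (fun V => _) = F' (i, j)); first by have [] := F'P (i, j).
  by apply/funext => V; rewrite mxE.
rewrite -(near_eq_derive _ (nFG V UV)) derive_mx; last first.
  exact/diff_derivable/dmx.
by apply/matrixP => i j; rewrite !mxE; have [_ ->] := F'P (i, j).
Unshelve. all: by end_near. Qed.

End ColumnAlgebra.

Section ScaleColumns.
Context {R : realType} {n : nat}.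
Implicit Types B V : 'M[R]_n.

Definition scale_columns B V : 'M[R]_n :=
  \matrix_(i, k) (V i k / enorm (B *m col k V)).

Lemma scale_columns_smooth B : smooth_on (regular_columns B) (scale_columns B).
Proof.
apply: column_algebra_smooth => i k.
rewrite (_ : (fun V => _) =
  (fun V => V i k) * (fun V => (enorm (B *m col k V))^-1)).
  by apply: column_algebraM;
    [exact: column_algebra_coord|exact: column_algebra_inv].
by apply/funext => V; rewrite mxE.
Qed.

Lemma normalize_columnsE : @normalize_columns R n = scale_columns 1%:M.
Proof.
by apply/funext => V; apply/matrixP => i k; rewrite !mxE mul1mx.
Qed.

End ScaleColumns.

(** * Convex hulls and separation *)

Lemma sum_continuous (R : realType) (T : topologicalType) m
    (f : 'I_m -> T -> R) :
  (forall i, continuous (f i)) -> continuous (fun x => \sum_i f i x).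
Proof. by move=> cf; apply: continuous_big => //; exact: add_continuous. Qed.

Section DotProduct.
Context {R : realType} {n : nat}.
Implicit Types (x y z : 'cV[R]_n) (a : R).

Lemma dotvE x y : dotv x y = (x^T *m y) 0 0.
Proof. by rewrite mxE; apply: eq_bigr => i _; rewrite mxE. Qed.

Lemma dotvC x y : dotv x y = dotv y x.
Proof. by apply: eq_bigr => i _; rewrite mulrC. Qed.

Lemma dotvDr x y z : dotv x (y + z) = dotv x y + dotv x z.
Proof. by rewrite !dotvE mulmxDr mxE. Qed.

Lemma dotvZr a x y : dotv x (a *: y) = a * dotv x y.
Proof. by rewrite !dotvE -scalemxAr mxE. Qed.

Lemma dotvNr x y : dotv x (- y) = - dotv x y.
Proof. by rewrite -scaleN1r dotvZr mulN1r. Qed.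

Lemma dotvBr x y z : dotv x (y - z) = dotv x y - dotv x z.
Proof. by rewrite dotvDr dotvNr. Qed.

Lemma dotv0r x : dotv x 0 = 0.
Proof. by rewrite -(scale0r 0) dotvZr mul0r. Qed.

Lemma dotv0l x : dotv 0 x = 0.
Proof. by rewrite dotvC dotv0r. Qed.

Lemma dotvDl x y z : dotv (x + y) z = dotv x z + dotv y z.
Proof. by rewrite dotvC dotvDr !(dotvC z). Qed.

Lemma dotvZl a x y : dotv (a *: x) y = a * dotv x y.
Proof. by rewrite dotvC dotvZr dotvC. Qed.

Lemma dotvNl x y : dotv (- x) y = - dotv x y.
Proof. by rewrite dotvC dotvNr dotvC. Qed.

Lemma dotvBl x y z : dotv (x - y) z = dotv x z - dotv y z.
Proof. by rewrite dotvDl dotvNl. Qed.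

Lemma dotv_sumr (I : finType) x (F : I -> 'cV[R]_n) :
  dotv x (\sum_i F i) = \sum_i dotv x (F i).
Proof.
by rewrite !dotvE mulmx_sumr summxE; apply: eq_bigr => i _; rewrite dotvE.
Qed.

Lemma dotv_ge0 x : 0 <= dotv x x.
Proof. by apply: sumr_ge0 => i _; rewrite -expr2 sqr_ge0. Qed.

Lemma dotv_eq0 x : (dotv x x == 0) = (x == 0).
Proof.
apply/eqP/eqP => [/eqP|->]; last exact: dotv0r.
rewrite psumr_eq0; last by move=> i _; rewrite -expr2 sqr_ge0.
move=> /allP xx0; apply/colP => i; rewrite mxE; apply/eqP.
by have := xx0 i (mem_index_enum i); rewrite /= mulf_eq0 orbb.
Qed.

Lemma dotv_gt0 x : (0 < dotv x x) = (x != 0).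
Proof. by rewrite lt0r dotv_eq0 dotv_ge0 andbT. Qed.

Lemma enorm_eq1 x : enorm x = 1 <-> dotv x x = 1.
Proof.
rewrite /enorm; split=> [x1|->]; last exact: sqrtr1.
by rewrite -[LHS](sqr_sqrtr (dotv_ge0 x)) x1 expr1n.
Qed.

Lemma gramE (M N : 'M[R]_n) i j : (M^T *m N) i j = dotv (col i M) (col j N).
Proof. by rewrite mxE; apply: eq_bigr => k _; rewrite !mxE. Qed.

Lemma tr_mulmx_dotv (M : 'M[R]_n) x k : (M^T *m x) k 0 = dotv (col k M) x.
Proof. by rewrite mxE; apply: eq_bigr => i _; rewrite !mxE. Qed.

Lemma dotv_continuous x : continuous (dotv x).
Proof.
apply: sum_continuous => i y; apply: continuousM; first exact: cst_continuous.
exact: coord_continuous.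
Qed.

End DotProduct.

Section ConvexHull.
Context {R : realType} {n : nat}.
Implicit Types (C S : set 'cV[R]_n) (x y u : 'cV[R]_n).

Lemma convex_setE C : @convex_set R 'cV[R]_n C <->
  forall x y (t : R), 0 <= t -> t <= 1 -> C x -> C y ->
    C (t *: x + (1 - t) *: y).
Proof.
split=> [cC x y t t0 t1 Cx Cy|cC x y t /set_mem Cx /set_mem Cy].
  exact: (set_mem (cC x y (Itv01 t0 t1) (mem_set Cx) (mem_set Cy))).
have t0 : 0 <= t%:num by [].
have t1 : t%:num <= 1 by [].
exact/mem_set/(cC x y _ t0 t1 Cx Cy).
Qed.

Lemma convex_conv_hull S : @convex_set R 'cV[R]_n (conv_hull S).
Proof.
apply/convex_setE => x y t t0 t1 Sx Sy C CS; have [/convex_setE cC _] := CS.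
by apply: (cC x y t t0 t1); [exact: Sx|exact: Sy].
Qed.

Lemma sub_conv_hull S : S `<=` conv_hull S.
Proof. exact: sub_gen_smallest. Qed.

Lemma conv_hull_sub S C :
  @convex_set R 'cV[R]_n C -> S `<=` C -> conv_hull S `<=` C.
Proof. exact: smallest_sub. Qed.

Lemma conv_hull_mono S C : S `<=` C -> conv_hull S `<=` conv_hull C.
Proof.
move=> SC; apply: conv_hull_sub; first exact: convex_conv_hull.
by move=> x /SC; exact: sub_conv_hull.
Qed.

(** By induction: the first point is split off and the other weights are divided by their sum [s].
    If [s] is 0 they all vanish. *)
Lemma convex_sum C m (t : 'I_m -> R) (a : 'I_m -> 'cV[R]_n) :
  @convex_set R 'cV[R]_n C -> (forall i, 0 <= t i) -> \sum_i t i = 1 ->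
  (forall i, C (a i)) -> C (\sum_i t i *: a i).
Proof.
move=> /convex_setE cC; elim: m t a => [|m IHm] t a t0 t1 Ca.
  by move: t1; rewrite big_ord0 => /eqP; rewrite eq_sym oner_eq0.
rewrite big_ord_recl; rewrite big_ord_recl in t1.
set s := \sum_(i < m) t (lift ord0 i) in t1.
have s0 : 0 <= s by exact: sumr_ge0.
have [s_eq0|s_neq0] := eqVneq s 0.
  have /eqP := s_eq0; rewrite psumr_eq0 // => /allP ti0.
  rewrite big1 => [|i _].
    by rewrite s_eq0 addr0 in t1; rewrite t1 scale1r addr0.
  by rewrite (eqP (ti0 i (mem_index_enum i))) scale0r.
have -> : \sum_(i < m) t (lift ord0 i) *: a (lift ord0 i) =
    (1 - t ord0) *: \sum_(i < m) (t (lift ord0 i) / s) *: a (lift ord0 i).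
  rewrite -t1 addrC addKr scaler_sumr; apply: eq_bigr => i _.
  by rewrite scalerA mulrC divfK.
apply: cC => //; first by rewrite -t1 lerDl.
apply: IHm => //; first by move=> i; rewrite divr_ge0.
by rewrite -mulr_suml divff.
Qed.

(** The missing weight is placed on the origin, added as an extra point with index [ord0]. *)
Lemma convex_subsum C m (t : 'I_m -> R) (a : 'I_m -> 'cV[R]_n) :
  @convex_set R 'cV[R]_n C -> C 0 -> (forall i, 0 <= t i) -> \sum_i t i <= 1 ->
  (forall i, C (a i)) -> C (\sum_i t i *: a i).
Proof.
move=> cC C0 t0 t1 Ca.
pose t' (i : 'I_m.+1) :=
  if unlift ord0 i is Some j then t j else 1 - \sum_i t i.
pose a' (i : 'I_m.+1) := if unlift ord0 i is Some j then a j else 0.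
have t'E j : t' (lift ord0 j) = t j by rewrite /t' liftK.
have a'E j : a' (lift ord0 j) = a j by rewrite /a' liftK.
have <- : \sum_i t' i *: a' i = \sum_i t i *: a i.
  rewrite big_ord_recl {1}/a' unlift_none scaler0 add0r.
  by apply: eq_bigr => j _; rewrite t'E a'E.
apply: convex_sum => // [i||i]; last by rewrite /a'; case: unliftP.
- by rewrite /t'; case: unliftP => // _; rewrite subr_ge0.
- rewrite big_ord_recl {1}/t' unlift_none.
  by under [X in _ + X]eq_bigr do rewrite t'E; rewrite subrK.
Qed.

Lemma convex_lt u c : @convex_set R 'cV[R]_n [set y | dotv u y < c].
Proof.
apply/convex_setE => x y t t0 t1 /= xc yc; rewrite dotvDr !dotvZr.
have [->|tn0] := eqVneq t 0; first by rewrite mul0r add0r subr0 mul1r.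
have tp : 0 < t by rewrite lt0r tn0.
by nra.
Qed.

Lemma convex_le u c : @convex_set R 'cV[R]_n [set y | dotv u y <= c].
Proof.
by apply/convex_setE => x y t t0 t1 /= xc yc; rewrite dotvDr !dotvZr; nra.
Qed.

(** The point [x] together with the open half-space below it is convex and contains [S], hence also
    the hull; it meets the supporting hyperplane only in [x]. *)
Lemma exposed_vertex S x u : S x ->
  (forall y, S y -> y != x -> dotv u y < dotv u x) -> vertex (conv_hull S) x.
Proof.
move=> Sx uS; exists u, (dotv u x); split.
  apply: conv_hull_sub; first exact: convex_le.
  move=> y Sy /=; have [->//|yx] := eqVneq y x.
  exact/ltW/uS.
pose C := [set x] `|` [set y | dotv u y < dotv u x].
have SC : conv_hull S `<=` C.
  apply: conv_hull_sub; last first.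
    move=> y Sy; have [->|yx] := eqVneq y x; first by left.
    by right; exact: uS.
  apply/convex_setE => y z t t0 t1 Cy Cz.
  have [->|tn0] := eqVneq t 0; first by rewrite scale0r add0r subr0 scale1r.
  have [->|tn1] := eqVneq t 1; first by rewrite subrr scale0r addr0 scale1r.
  have tp : 0 < t by rewrite lt0r tn0.
  have tp1 : t < 1 by rewrite lt_neqAle tn1.
  case: Cy Cz => [->|/= yx] [->|/= zx]; first last.
  - by right; rewrite /= dotvDr !dotvZr; nra.
  - by right; rewrite /= dotvDr !dotvZr; nra.
  - by right; rewrite /= dotvDr !dotvZr; nra.
  - by left; rewrite -scalerDl addrC subrK scale1r.
apply/seteqP; split=> [_ ->|y [/SC Cy /= yx]].
  by split=> //; exact: sub_conv_hull.
by case: Cy => // /=; rewrite yx ltxx.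
Qed.

(** If [x] were not in [S], all of [S], and with it the hull, would lie strictly below the
    hyperplane that exposes [x]. *)
Lemma vertex_conv_hull_mem S x : vertex (conv_hull S) x -> S x.
Proof.
move=> [u [c [uc xE]]]; apply: contrapT => nSx.
have [Sx ux] : (conv_hull S `&` [set y | dotv u y = c]) x by rewrite -xE.
have : conv_hull S `<=` [set y | dotv u y < c].
  apply: conv_hull_sub; first exact: convex_lt.
  move=> y Sy /=; rewrite lt_neqAle uc ?andbT; last exact: sub_conv_hull.
  apply/eqP => uy; apply: nSx; suff -> : x = y by [].
  suff : [set x] y by [].
  by rewrite xE; split=> //; exact: sub_conv_hull.
by move=> /(_ _ Sx) /=; rewrite ux ltxx.
Qed.

(* The separating direction is [x - y] where [y] is the point of the hull
   closest to [x]. *)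
Lemma separation_conv_hull m (a : 'I_m -> 'cV[R]_n) x :
  ~ conv_hull (range a) x -> exists u, forall i, dotv u (a i) < dotv u x.
Proof.
case: m a => [|m] a nx; first by exists 0 => -[].
(* The closest point is found by minimizing the squared distance over the compact simplex of
   weights. *)
pose T := [set t : 'rV[R]_m.+1 | forall i, t ord0 i \in `[0, 1]] `&`
  [set t : 'rV[R]_m.+1 | \sum_i t 0 i = 1].
pose p (t : 'rV[R]_m.+1) := \sum_i t 0 i *: a i.
have sum_cont (b : 'I_m.+1 -> R) :
    continuous (fun t : 'rV[R]_m.+1 => \sum_j t 0 j * b j).
  apply: sum_continuous => j t; apply: continuousM.
    exact: coord_continuous.
  exact: cst_continuous.
have cT : compact T.
  have cbox : compact [set t : 'rV[R]_m.+1 | forall i, t ord0 i \in `[0, 1]].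
    apply: (@rV_compact _ _ (fun=> `[0 : R, 1]%classic)) => _.
    exact: segment_compact.
  apply: (compact_closedI cbox).
  rewrite (_ : [set _ | _] =
    (fun t : 'rV[R]_m.+1 => \sum_j t 0 j * 1) @^-1` [set x | x = 1]).
    apply: preimage_closed; last exact: closed_eq.
    by move=> t _; exact: sum_cont.
  by apply/seteqP; split=> t /= t1; rewrite -[RHS]t1; apply: eq_bigr => j _;
    rewrite mulr1.
have T0 : T !=set0.
  exists (delta_mx 0 0); split.
    by move=> i; rewrite mxE /=; case: eqP; rewrite in_itv/= ?ler01 ?lexx.
  rewrite /= (bigD1 ord0)//= mxE !eqxx big1 ?addr0// => i i0.
  by rewrite mxE (negbTE i0).
pose d t := dotv (p t - x) (p t - x).
have cd : continuous d.
  apply: sum_continuous => i t.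
  have ci : {for t, continuous (fun t : 'rV[R]_m.+1 => (p t - x) i 0)}.
    have -> : (fun t : 'rV[R]_m.+1 => (p t - x) i 0) =
        (fun t : 'rV[R]_m.+1 => \sum_j t 0 j * a j i 0) - cst (x i 0).
      apply/funext => s; rewrite !mxE summxE; congr (_ - _).
      by apply: eq_bigr => j _; rewrite mxE.
    by apply: continuousB; [exact: sum_cont|exact: cst_continuous].
  exact: continuousM.
have [t /set_mem [t01 t1] tmin] :=
  EVT_min_rV T0 cT (continuous_subspaceT cd).
have {}t01 i : 0 <= t 0 i <= 1 by have := t01 i; rewrite in_itv.
pose y := p t.
have Cy : conv_hull (range a) y.
  apply: convex_sum => //; first exact: convex_conv_hull.
    by move=> i; have /andP[] := t01 i.
  by move=> i; apply: sub_conv_hull; exists i.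
exists (x - y) => i.
have yx : 0 < dotv (x - y) (x - y).
  by rewrite dotv_gt0 subr_eq0; apply: contra_not_neq nx => ->.
suff : dotv (x - y) (a i - y) <= 0.
  by move: yx; rewrite !dotvBr; lra.
rewrite leNgt; apply/negP => al0.
set al := dotv _ _ in al0; pose be := dotv (a i - y) (a i - y).
have be0 : 0 <= be by exact: dotv_ge0.
(* Moving from [y] towards [a i] by a fraction [l] changes the squared distance by
   [- 2 l al + l^2 be]. This choice keeps [l <= 1], and as [l be <= al] the change is at most
   [- l al < 0], against minimality. *)
pose l := al / (be + al).
have l0 : 0 < l by rewrite divr_gt0 // ltr_wpDl.
have l1 : l <= 1 by rewrite ler_pdivrMr ?mul1r ?lerDr // ltr_wpDl.
pose s : 'rV[R]_m.+1 := (1 - l) *: t + l *: delta_mx 0 i.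
have ps : p s - x = y - x + l *: (a i - y).
  have -> : p s = (1 - l) *: y + l *: a i.
    rewrite /y /p scaler_sumr [in RHS](_ : a i = \sum_j (j == i)%:R *: a j).
      rewrite scaler_sumr -big_split; apply: eq_bigr => j _ /=.
      by rewrite /s !mxE eqxx /= [LHS]scalerDl !scalerA.
    rewrite (bigD1 i)//= eqxx scale1r big1 ?addr0// => j /negbTE ->.
    by rewrite scale0r.
  by apply/colP => j; rewrite !mxE; ring.
have Ts : T s.
  split=> [j|/=].
    rewrite /= in_itv/= !mxE eqxx /=; have /andP[] := t01 j.
    by case: (j == i); rewrite ?mulr1 ?mulr0 => ? ?; apply/andP; split; nra.
  under eq_bigr do rewrite !mxE eqxx /=.
  rewrite big_split/= -!mulr_sumr t1 (bigD1 i)//= eqxx big1 ?addr0 ?subrK//.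
    by rewrite !mulr1 subrK.
  by move=> j /negbTE ->.
have := tmin s (mem_set Ts).
have dE z w : dotv (z + l *: w) (z + l *: w) =
    dotv z z + 2 * l * dotv z w + l ^+ 2 * dotv w w.
  by rewrite dotvDl !dotvDr !dotvZl !dotvZr (dotvC w z); ring.
rewrite /d ps -/y dE -/be -(opprB x y) [dotv (- _) (a i - y)]dotvNl -/al.
have lE : l * (be + al) = al by rewrite divfK// gt_eqF// ltr_wpDl.
nra.
Qed.

End ConvexHull.

(** * Polytopes *)

Section Hyperplane.
Context {R : realType} {n : nat}.
Implicit Types (u y : 'cV[R]_n).

(** The codomain is [R^o], the scalars as a vector space over themselves, so that [linfun] and
    rank-nullity apply. *)
Definition dotf u (y : 'cV[R]_n) : R^o := dotv u y.

Fact dotf_is_linear u : linear (dotf u).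
Proof. by move=> a x y; rewrite /dotf dotvDr dotvZr. Qed.

HB.instance Definition _ u :=
  GRing.isLinear.Build R 'cV[R]_n R^o _ (dotf u) (dotf_is_linear u).

Definition hyperplane u : {vspace 'cV[R]_n} := lker (linfun (dotf u)).

Lemma mem_hyperplane u y : (y \in hyperplane u) = (dotv u y == 0).
Proof. by rewrite memv_ker lfunE. Qed.

(** Rank-nullity: the image lies in a line and is nonzero because it contains [dotv u u]. *)
Lemma dim_hyperplane u : u != 0 -> \dim (hyperplane u) = n.-1.
Proof.
move=> u0; have := limg_ker_dim (linfun (dotf u)) fullv.
have -> : \dim {:'cV[R]_n} = n by rewrite dimvf; exact: muln1.
rewrite capfv => dimE.
suff : \dim (limg (linfun (dotf u))) = 1%N.
  by move=> dim1; move: dimE; rewrite dim1 addn1 => /(congr1 predn).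
apply/eqP; rewrite eqn_leq; apply/andP; split.
  by rewrite (leq_trans (dimvS (subvf _)))// dimvf.
rewrite lt0n dimv_eq0; apply: contraNneq u0 => img0.
have : linfun (dotf u) u \in limg (linfun (dotf u)) by rewrite memv_img ?memvf.
by rewrite img0 memv0 lfunE /= /dotf dotv_eq0.
Qed.

End Hyperplane.

Section PolytopeVertices.
Context {R : realType} {n : nat}.
Implicit Types (P S : set 'cV[R]_n) (s : seq 'cV[R]_n).

Lemma vertex_mem P x : vertex P x -> P x.
Proof.
move=> [u [c [_ xE]]]; have : [set x] x by [].
by rewrite xE => -[].
Qed.

(* In a generating list of minimal length no point lies in the hull of the
   others, so each one is exposed by a separating hyperplane. *)
Lemma polytope_conv_vertices P :
  polytope P -> P = conv_hull [set x | vertex P x].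
Proof.
move=> [S [/finite_seqP[s0 ->] P0]].
pose gen m := `[< exists2 s, size s = m & P = conv_hull [set` s] >].
have exgen : exists m, gen m by exists (size s0); apply/asboolP; exists s0.
case: (ex_minnP exgen) => m /asboolP[s sm Ps] mmin.
apply/seteqP; split; last first.
  rewrite [X in _ `<=` X]Ps; apply: conv_hull_sub.
    exact: convex_conv_hull.
  by move=> x /= /vertex_mem; rewrite {1}Ps.
rewrite {1}Ps; apply: conv_hull_mono => x /= xs; rewrite Ps.
pose s' := [seq y <- s | y != x].
have szs' : (size s' < m)%N.
  rewrite -sm size_filter -(count_predC (pred1 x)) -[ltnLHS]add0n ltn_add2r.
  by rewrite -has_count has_pred1.
have nx : ~ conv_hull [set` s'] x.
  move=> xs'; have /mmin : gen (size s'); last by rewrite leqNgt szs'.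
  apply/asboolP; exists s' => //; rewrite Ps; apply/seteqP; split.
    apply: conv_hull_sub; first exact: convex_conv_hull.
    move=> y /= ys; have [->//|yx] := eqVneq y x.
    by apply: sub_conv_hull; rewrite /= mem_filter yx.
  by apply: conv_hull_mono => y /=; rewrite mem_filter => /andP[].
have rs' : range (fun i : 'I_(size s') => nth 0 s' i) = [set` s'].
  apply/seteqP; split=> [_ [i _ <-]/=|y /= ys']; first exact: mem_nth.
  have ys'' : (index y s' < size s')%N by rewrite index_mem.
  by exists (Ordinal ys'') => //=; rewrite nth_index.
rewrite -rs' in nx; have [u us'] := separation_conv_hull nx.
apply: (exposed_vertex (u := u)) => //= y ys yx.
have ys' : y \in s' by rewrite mem_filter yx.
have ys'' : (index y s' < size s')%N by rewrite index_mem.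
by have := us' (Ordinal ys''); rewrite /= nth_index.
Qed.

(** From an interior point a short step along [w] stays in [P] and raises [dotv w] by a positive
    multiple of [dotv w w]. *)
Lemma interior_not_hyperplane P (w : 'cV[R]_n) :
  P° !=set0 -> (forall y, P y -> dotv w y = 0) -> w = 0.
Proof.
move=> [p Pp] Pw; apply/eqP; rewrite -dotv_eq0.
have cf : {for 0, continuous (fun e : R => e *: w + p)}.
  apply: cvgD; last exact: cvg_cst.
  exact: scalel_continuous.
have /nbhs_ballP[e /= e0 eP] : \forall e \near (0 : R), P (e *: w + p).
  by apply: cf; rewrite scale0r add0r.
have /Pw : P ((e / 2) *: w + p).
  apply: eP; rewrite /ball/= sub0r normrN gtr0_norm ?divr_gt0//.
  by rewrite ltr_pdivrMr// ltr_pMr// ltrDl.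
rewrite dotvDr dotvZr (Pw p (interior_subset Pp)) addr0 => /eqP.
by rewrite mulf_eq0 gt_eqF ?divr_gt0.
Qed.

End PolytopeVertices.

(** * Cross polytopes in dual coordinates: vertices, facets and tangency *)

Section CrossPolytope.
Context {R : realType} {n : nat}.
Variables V W : 'M[R]_n.
Hypothesis WV : W^T *m V = 1%:M.
Hypothesis n_gt0 : (0 < n)%N.

Local Notation v k := (col k V).
Local Notation w k := (col k W).

Definition cross_vertices (M : 'M[R]_n) : set 'cV[R]_n :=
  [set x | exists k, x = col k M \/ x = - col k M].

Let P := conv_hull (cross_vertices V).

Lemma dual_dotv j k : dotv (w j) (v k) = (j == k)%:R.
Proof. by rewrite -gramE WV mxE. Qed.

Lemma dual_expansion y : y = \sum_k dotv (w k) y *: v k.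
Proof.
rewrite -[LHS]mul1mx -(mulmx1C WV) -mulmxA; apply/colP => i.
rewrite mxE summxE; apply: eq_bigr => k _.
by rewrite tr_mulmx_dotv !mxE mulrC.
Qed.

Lemma dotv_dual x y : dotv x y = \sum_k dotv (w k) y * dotv x (v k).
Proof.
rewrite {1}(dual_expansion y) dotv_sumr.
by apply: eq_bigr => k _; rewrite dotvZr.
Qed.

Lemma cross_vertex_mem k : P (v k).
Proof. by apply: sub_conv_hull; exists k; left. Qed.

Lemma cross_vertexN_mem k : P (- v k).
Proof. by apply: sub_conv_hull; exists k; right. Qed.

Lemma cross0 : P 0.
Proof.
have /convex_setE cP := @convex_conv_hull R n (cross_vertices V).
pose k0 := Ordinal n_gt0.
have := cP (v k0) (- v k0) 2^-1 _ _
  (cross_vertex_mem k0) (cross_vertexN_mem k0).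
rewrite (_ : 2^-1 *: _ + _ = 0); last first.
  by rewrite scalerN -scalerBl (_ : _ - _ = 0) ?scale0r//; field.
by apply; rewrite ?invr_ge0 ?invf_le1 ?ler1n.
Qed.

(** The numbers [dotv (w k) y] are the coordinates of [y] in the basis [v k], so in these
    coordinates [P] is the unit ball of the l1 norm. *)
Lemma crossE y : P y <-> \sum_k `|dotv (w k) y| <= 1.
Proof.
split=> [|y1]; last first.
  rewrite (dual_expansion y).
  (* The signs of the coordinates move into the choice of vertex, which leaves nonnegative weights
     of sum at most 1. *)
  pose a k := if 0 <= dotv (w k) y then v k else - v k.
  have -> : \sum_k dotv (w k) y *: v k = \sum_k `|dotv (w k) y| *: a k.
    apply: eq_bigr => k _; rewrite /a; case: ifPn => [/ger0_norm ->//|].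
    by rewrite -ltNge => /ltr0_norm ->; rewrite scaleNr scalerN opprK.
  apply: convex_subsum => //; [exact: convex_conv_hull|exact: cross0|].
  move=> k; rewrite /a; case: ifP => _;
    [exact: cross_vertex_mem|exact: cross_vertexN_mem].
move: y; apply: conv_hull_sub.
  apply/convex_setE => y z t t0 t1 /= yP zP.
  have : \sum_k (t * `|dotv (w k) y| + (1 - t) * `|dotv (w k) z|) <= 1.
    by rewrite big_split /= -!mulr_sumr; nra.
  apply: le_trans; apply: ler_sum => k _; rewrite dotvDr !dotvZr.
  rewrite (le_trans (ler_normD _ _))// !normrM (ger0_norm t0).
  by rewrite (@ger0_norm _ (1 - t)) ?subr_ge0.
have vP k : \sum_j `|dotv (w j) (v k)| <= 1.
  rewrite (bigD1 k)//= dual_dotv eqxx normr1 big1 ?addr0// => j /negbTE jk.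
  by rewrite dual_dotv jk normr0.
move=> y [k [->|->]]/=; first exact: vP.
by under eq_bigr do rewrite dotvNr normrN; exact: vP.
Qed.

Lemma cross_interior : P° 0.
Proof.
pose g (y : 'cV[R]_n) := \sum_k `|dotv (w k) y|.
have cg : continuous g.
  apply: sum_continuous => k y.
  apply: (@continuous_comp _ _ _ (dotv (w k)) Num.norm).
    exact: dotv_continuous.
  exact: norm_continuous.
have g0 : g 0 < 1 by rewrite /g big1 // => k _; rewrite dotv0r normr0.
have : nbhs (0 : 'cV[R]_n) (g @^-1` [set x | x < 1]).
  by apply: cg; apply: open_nbhs_nbhs; split; [exact: open_lt|].
by apply: filterS => y /ltW gy; apply/crossE.
Qed.

Lemma cross_vertices_finite : finite_set (cross_vertices V).
Proof.
have -> : cross_vertices V =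
    range (fun k => v k) `|` range (fun k => - v k).
  apply/seteqP; split=> [x [k [->|->]]|x [[k _ <-]|[k _ <-]]].
  - by left; exists k.
  - by right; exists k.
  - by exists k; left.
  - by exists k; right.
by rewrite finite_setU; split; apply: finite_image.
Qed.

(** The functional [w k] is 1 at [v k], -1 at [- v k] and 0 at the other vertices; so [w k] exposes
    [v k], and [- w k] exposes [- v k]. *)
Lemma cross_verticesE : [set x | vertex P x] = cross_vertices V.
Proof.
apply/seteqP; split=> x; first exact: vertex_conv_hull_mem.
have dw k y : cross_vertices V y -> y != v k -> dotv (w k) y < 1.
  move=> [j [->|->]]; last first.
    by rewrite dotvNr dual_dotv (le_lt_trans _ ltr01)// oppr_le0 ler0n.
  by rewrite dual_dotv; case: (eqVneq k j) => [->|]; rewrite ?eqxx.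
move=> [k [->|->]].
  apply: (exposed_vertex (u := w k)); first by exists k; left.
  by rewrite dual_dotv eqxx => y; exact: dw.
apply: (exposed_vertex (u := - w k)); first by exists k; right.
move=> y Sy yk; rewrite !dotvNl dotvNr opprK dual_dotv eqxx -dotvNr.
apply: dw; last by rewrite eqr_oppLR.
by case: Sy => j [->|->]; exists j; [right|left]; rewrite ?opprK.
Qed.

Lemma cross_labeled : labeled_cross_polytope P V.
Proof.
split; last exact: cross_verticesE.
- by exists (cross_vertices V); split=> //; exact: cross_vertices_finite.
- by exists 0; exact: cross_interior.
Qed.

(** These are the sums of the [w k] with signs, the vertices of the polar parallelotope. *)
Definition sign_vector x := forall k, `|dotv x (v k)| = 1.

Lemma sign_vector_le x y : sign_vector x -> P y -> dotv x y <= 1.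
Proof.
move=> xs; move: y; apply: conv_hull_sub; first exact: convex_le.
move=> y [k [->|->]] /=; rewrite ?dotvNr -?normrN -(xs k) ?ler_norm//.
by rewrite -normrN ler_norm.
Qed.

Lemma sign_vector_sqr x k : sign_vector x -> dotv x (v k) * dotv x (v k) = 1.
Proof.
by move=> xs; rewrite -expr2 -real_normK ?num_real// xs expr1n.
Qed.

Lemma sign_facet_vertex x k : sign_vector x ->
  (P `&` [set y | dotv x y = 1]) (dotv x (v k) *: v k).
Proof.
move=> xs; split; last by rewrite /= dotvZr sign_vector_sqr.
have := xs k; case: (ler0P (dotv x (v k))) => _ xk.
  by rewrite -[dotv x _]opprK xk scaleN1r; exact: cross_vertexN_mem.
by rewrite xk scale1r; exact: cross_vertex_mem.
Qed.

Lemma sign_facet x : sign_vector x ->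
  facet P (P `&` [set y | dotv x y = 1]).
Proof.
move=> xs; split.
  by exists x, 1; split=> // y; exact: sign_vector_le.
pose s k := dotv x (v k).
have ss k : s k * s k = 1 by exact: sign_vector_sqr.
pose F := P `&` [set y | dotv x y = 1].
have Fv k : F (s k *: v k) by exact: sign_facet_vertex.
have x0 : x != 0.
  apply: contra_eq_neq (xs (Ordinal n_gt0)) => ->.
  by rewrite dotv0l normr0 eq_sym oner_eq0.
set k0 := Ordinal n_gt0.
exists (s k0 *: v k0), (hyperplane x).
split; [exact: Fv|exact: dim_hyperplane|].
move=> U; split=> [/subvP xU y [_ /= xy]|FU].
  by apply: xU; rewrite mem_hyperplane dotvBr xy dotvZr ss subrr.
apply/subvP => y; rewrite mem_hyperplane => /eqP xy.
rewrite (dual_expansion y).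
(* The facet contains every [s k *: v k]. The differences from the one at [k0] span the directions
   orthogonal to [x]: the correction term has coefficient
   [\sum_k dotv (w k) y * s k = dotv x y = 0]. *)
have -> : \sum_k dotv (w k) y *: v k =
    \sum_k (dotv (w k) y * s k) *: (s k *: v k - s k0 *: v k0).
  under [RHS]eq_bigr do rewrite scalerBr scalerA -mulrA ss mulr1.
  rewrite sumrB -scaler_suml (_ : \sum_k _ * _ = 0) ?scale0r ?subr0//.
  by rewrite -[RHS]xy [RHS]dotv_dual.
by apply: memv_suml => k _; apply/memvZ/FU/Fv.
Qed.

(** Symmetry bounds every [dotv u (v k)] by [c] in absolute value. The dimension of [F] forces
    [c > 0] and equality for each [k]; the sign vector is then [u] divided by [c]. *)
Lemma facet_sign F : facet P F ->
  exists2 x, sign_vector x & F = P `&` [set y | dotv x y = 1].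
Proof.
move=> [[u [c [uc FE]]] [x0 [U [Fx0 dimU UF]]]].
have av k : `|dotv u (v k)| <= c.
  rewrite ler_norml; apply/andP; split; last exact: (uc _ (cross_vertex_mem k)).
  by rewrite lerNl -dotvNr; exact: (uc _ (cross_vertexN_mem k)).
have c0 : 0 < c.
  rewrite lt_neqAle (le_trans _ (av (Ordinal n_gt0)))// andbT.
  (* If [c = 0], then [u] vanishes everywhere and [F] is all of [P], whose directions fill the whole
     space; as [n > 0], this exceeds dimension [n.-1]. *)
  apply/eqP => c0; have uv0 k : dotv u (v k) = 0.
    by apply/eqP; rewrite -normr_le0 c0.
  have u0 y : dotv u y = 0.
    by rewrite dotv_dual big1 // => k _; rewrite uv0 mulr0.
  have Uv k : v k \in U.
    have [/(_ (subvv U)) FU _] := UF U.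
    have vU : v k - x0 \in U.
      by apply: FU; rewrite FE; split; [exact: cross_vertex_mem|rewrite /= u0].
    have nvU : - v k - x0 \in U.
      by apply: FU; rewrite FE; split; [exact: cross_vertexN_mem|rewrite /= u0].
    have -> : v k = 2^-1 *: ((v k - x0) - (- v k - x0)).
      by apply/colP => i; rewrite !mxE; field.
    by rewrite memvZ// memvB.
  have : (fullv <= U)%VS.
    apply/subvP => y _; rewrite (dual_expansion y).
    by apply: memv_suml => k _; exact: memvZ.
  move/dimvS; rewrite dimU dimvf [X in (X <= _)%N]muln1.
  by rewrite leqNgt; move/negP; apply; rewrite ltn_predL.
have Fc y : F y -> dotv u y = c by rewrite FE => -[].
have u0 : u != 0.
  by apply: contraTneq c0 => u0; rewrite -(Fc _ Fx0) u0 dotv0l ltxx.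
have ac k : `|dotv u (v k)| = c.
  apply/eqP; rewrite eq_le av /= leNgt; apply/negP => ak.
  (* With [t] the absolute value of the [k]-th coordinate, [c = dotv u y] is at most
     [t * |dotv u (v k)| + c * (1 - t)], so a strict inequality at [k] forces [t = 0]. *)
  have Fw y : F y -> dotv (w k) y = 0.
    move=> Fy; have Py : P y by move: Fy; rewrite FE => -[].
    move/crossE : Py; rewrite (bigD1 k)//=; set t := `|dotv (w k) y| => t1.
    suff : t * (c - `|dotv u (v k)|) <= 0.
      by rewrite pmulr_lle0 ?subr_gt0// normr_le0 => /eqP.
    have : c <= t * `|dotv u (v k)| + c * \sum_(j | j != k) `|dotv (w j) y|.
      rewrite -{1}(Fc _ Fy) dotv_dual (le_trans (ler_norm _))//.
      rewrite (le_trans (ler_norm_sum _ _ _))// (bigD1 k)//= normrM lerD//.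
      rewrite mulr_sumr; apply: ler_sum => j _.
      by rewrite normrM mulrC ler_wpM2r.
    have : 0 <= t by exact: normr_ge0.
    by move: (av k); nra.
  (* Equality of dimensions identifies [U] with the orthogonal complements of both [u] and [w k].
     But [x0] is orthogonal to [w k], while [dotv u x0 = c > 0]. *)
  have Uu : U = hyperplane u.
    apply/eqP; rewrite eqEdim dim_hyperplane // dimU leqnn andbT.
    apply/UF => y Fy; rewrite mem_hyperplane dotvBr !Fc ?subrr//.
  have w0 : w k != 0.
    apply: contra_eq_neq (dual_dotv k k) => ->.
    by rewrite dotv0l eqxx eq_sym oner_eq0.
  have Uw : U = hyperplane (w k).
    apply/eqP; rewrite eqEdim dim_hyperplane // dimU leqnn andbT.
    apply/UF => y Fy; rewrite mem_hyperplane dotvBr !Fw ?subrr//.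
  have : x0 \in hyperplane u by rewrite -Uu Uw mem_hyperplane Fw.
  by rewrite mem_hyperplane (Fc _ Fx0) gt_eqF.
exists (c^-1 *: u) => [k|].
  by rewrite dotvZl normrM ac gtr0_norm ?invr_gt0// mulVf ?gt_eqF.
rewrite FE; congr (_ `&` _); apply/seteqP; split=> y /=; rewrite dotvZl.
  by move=> ->; rewrite mulVf ?gt_eqF.
by move=> /(congr1 ( *%R c)); rewrite mulrA divff ?gt_eqF// mul1r mulr1.
Qed.

(** A contact point [z] satisfies [dotv z y = 1] at every facet point [dotv x (v k) *: v k]. So [z]
    and [x] have the same products with the basis [v k], and [x] is the only possible contact
    point. *)
Lemma sign_facet_tangent x : sign_vector x ->
  tangent_to_sphere (P `&` [set y | dotv x y = 1]) <-> dotv x x = 1 /\ P x.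
Proof.
move=> xs; split=> [[z [/enorm_eq1 z1 [Pz /= xz] zF]]|[x1 Px]]; last first.
  exists x; split=> //; first exact/enorm_eq1.
  move=> y [_ /= xy].
  by rewrite /sphere_tangent_hyperplane /= dotvBr xy x1 subrr.
suff -> : x = z by [].
have zv k : dotv z (v k) = dotv x (v k).
  have := zF _ (sign_facet_vertex k xs).
  rewrite /sphere_tangent_hyperplane /= dotvBr dotvZr z1 => /eqP.
  rewrite subr_eq0 => /eqP/(congr1 ( *%R (dotv x (v k)))).
  by rewrite mulrA sign_vector_sqr // mul1r mulr1.
apply/eqP; rewrite -subr_eq0 -dotv_eq0 dotv_dual big1// => k _.
by rewrite dotvBl zv subrr mulr0.
Qed.

End CrossPolytope.

(** * Tight cross polytopes *)

Section TightCrossPolytopes.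
Context {R : realType} {n : nat}.
Implicit Types (A V W Q : 'M[R]_n) (P : set 'cV[R]_n).

Definition ellipsoid A : set 'cV[R]_n :=
  [set x | dotv (A *m x) (A *m x) = 1].

(** Tightness expressed on the label alone: the first two conditions encode tangency of the facets
    to the sphere, the third inscription in the ellipsoid. *)
Definition orthogonal_tight A V :=
  [/\ forall j k, j != k -> dotv (col j V) (col k V) = 0,
      \sum_k (dotv (col k V) (col k V))^-1 = 1
    & forall k, ellipsoid A (col k V)].

Lemma labeled_cross_polytopeE P V :
  labeled_cross_polytope P V -> P = conv_hull (cross_vertices V).
Proof. by move=> [/polytope_conv_vertices PE _ VE]; rewrite PE VE. Qed.

(** A vector orthogonal to all columns of [V] is orthogonal to the whole polytope, hence zero
    because the interior is nonempty. *)
Lemma labeled_cross_polytope_unitmx P V :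
  labeled_cross_polytope P V -> V \in unitmx.
Proof.
move=> LPV; have PE := labeled_cross_polytopeE LPV.
rewrite unitmxE unitfE; apply/negP => /det0P[u u0 uV].
move/eqP: u0; apply; apply: trmx_inj; rewrite trmx0.
case: LPV => _ P0 _; apply: (interior_not_hyperplane P0).
have uv k : dotv u^T (col k V) = 0.
  by rewrite dotvE trmxK colE mulmxA uV mul0mx mxE.
have uS y : cross_vertices V y -> dotv u^T y = 0.
  by move=> [k [->|->]]; rewrite ?dotvNr uv ?oppr0.
move=> y; rewrite PE => Py; apply/eqP; rewrite eq_le; apply/andP; split.
  by move: y Py; apply: conv_hull_sub; [exact: convex_le|move=> y /uS /= ->].
rewrite -oppr_le0 -dotvNl.
move: y Py; apply: conv_hull_sub; first exact: convex_le.
by move=> y /uS /=; rewrite dotvNl => ->; rewrite oppr0.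
Qed.

(* Flipping the sign of one summand does not change the norm, so the [j]-th
   summand is half-orthogonal to the sum; flipping a second sign then isolates
   a single inner product. *)
Lemma unit_sign_sums_orthogonal (w : 'I_n -> 'cV[R]_n) :
  (forall s : 'I_n -> R, (forall k, s k = 1 \/ s k = -1) ->
     dotv (\sum_k s k *: w k) (\sum_k s k *: w k) = 1) ->
  (forall j k, j != k -> dotv (w j) (w k) = 0) /\
  \sum_k dotv (w k) (w k) = 1.
Proof.
move=> ws.
pose S (s : 'I_n -> R) := \sum_k s k *: w k.
pose flip (j : 'I_n) (s : 'I_n -> R) k := if k == j then - s k else s k.
have flipS j s : S (flip j s) = S s - (2 * s j) *: w j.
  rewrite /S (bigD1 j)//= [in RHS](bigD1 j)//= /flip eqxx.
  rewrite (eq_bigr (fun k => s k *: w k)); last by move=> k /negbTE ->.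
  by apply/colP => i; rewrite !mxE; ring.
have flip_sign j s : (forall k, s k = 1 \/ s k = -1) ->
    forall k, flip j s k = 1 \/ flip j s k = -1.
  move=> ss k; rewrite /flip; case: ifP => // _.
  by case: (ss k) => ->; rewrite ?opprK; [right|left].
have dS j s : (forall k, s k = 1 \/ s k = -1) ->
    dotv (S s) (w j) = s j * dotv (w j) (w j).
  move=> ss; have := ws _ (flip_sign j s ss); rewrite -/(S _) flipS.
  rewrite dotvBl !dotvBr !dotvZl !dotvZr (ws _ ss) (dotvC (w j)).
  by case: (ss j) => ->; lra.
pose e (k : 'I_n) : R := 1.
have es k : e k = 1 \/ e k = -1 by left.
split=> [j k jk|].
  have := dS k _ (flip_sign j e es).
  rewrite flipS dotvBl dotvZl dS// /flip eq_sym (negbTE jk) /e.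
  lra.
have := ws _ es; rewrite {2}/e dotv_sumr => <-.
by apply: eq_bigr => k _; rewrite dotvZr dS// /e; lra.
Qed.

Lemma tight_orthogonal A V : (0 < n)%N ->
  tight_cross_polytopes (ellipsoid A) V -> orthogonal_tight A V.
Proof.
move=> n0 [P [LPV [_ insc circ]]].
have uV := labeled_cross_polytope_unitmx LPV.
pose W := (invmx V)^T.
have WV : W^T *m V = 1%:M by rewrite trmxK mulVmx.
have PE := labeled_cross_polytopeE LPV.
have [worth wsum] : (forall j k, j != k -> dotv (col j W) (col k W) = 0) /\
    \sum_k dotv (col k W) (col k W) = 1.
  apply: unit_sign_sums_orthogonal => s ss.
  set x := \sum_k _.
  have xs : sign_vector V x.
    move=> k; rewrite dotvC dotv_sumr (bigD1 k)//= big1 ?addr0 => [|j jk].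
      rewrite dotvZr dotvC (dual_dotv WV) eqxx mulr1.
      by case: (ss k) => ->; rewrite ?normrN normr1.
    by rewrite dotvZr dotvC (dual_dotv WV) (negbTE jk) mulr0.
  have := circ _ ; rewrite PE => /(_ _ (sign_facet WV n0 xs)).
  by move/(sign_facet_tangent WV xs) => [].
(* The Gram matrices of [V] and [W] are mutually inverse, and that of [W] is diagonal, so each entry
   of their product is a single term. *)
have gram j k :
    dotv (col j V) (col k V) * dotv (col k W) (col k W) = (j == k)%:R.
  have : ((V^T *m V) *m (W^T *m W)) j k = (j == k)%:R.
    rewrite mulmxA -(mulmxA V^T) (mulmx1C WV) mulmx1.
    by rewrite -[W]trmxK -trmx_mul WV trmx1 mxE.
  rewrite mxE (bigD1 k)//= big1 ?addr0 => [|i ik]; first by rewrite !gramE.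
  by rewrite !gramE worth ?mulr0.
have w0 k : dotv (col k W) (col k W) != 0.
  apply: contra_eq_neq (gram k k) => ->.
  by rewrite mulr0 eqxx eq_sym oner_eq0.
split=> [j k jk||k].
- apply: (mulIf (w0 k)).
  by rewrite gram (negbTE jk) mul0r.
- rewrite -[RHS]wsum; apply: eq_bigr => k _; have := gram k k; rewrite eqxx.
  move=> /(congr1 ( *%R (dotv (col k V) (col k V))^-1)).
  rewrite mulr1 mulKf//; apply: contra_eq_neq (gram k k) => ->.
  by rewrite mul0r eqxx eq_sym oner_eq0.
- apply: insc; have [_ _ VE] := LPV.
  have : cross_vertices V (col k V) by exists k; left.
  by rewrite -[cross_vertices V]VE.
Qed.

Lemma orthogonal_tight_tight A V : (0 < n)%N ->
  orthogonal_tight A V -> tight_cross_polytopes (ellipsoid A) V.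
Proof.
move=> n0 [vorth vsum vA].
have v0 k : 0 < dotv (col k V) (col k V).
  rewrite dotv_gt0; apply: contra_eq_neq (vA k) => ->.
  by rewrite mulmx0 dotv0r eq_sym oner_eq0.
(* For an orthogonal basis the dual vectors are [v_k / |v_k|^2]. *)
pose W : 'M[R]_n := \matrix_(i, k) (V i k / dotv (col k V) (col k V)).
have wE k : col k W = (dotv (col k V) (col k V))^-1 *: col k V.
  by apply/colP => i; rewrite !mxE mulrC.
have WV : W^T *m V = 1%:M.
  apply/matrixP => j k; rewrite gramE wE dotvZl mxE.
  case: (eqVneq j k) => [->|jk]; first by rewrite mulVf// gt_eqF.
  by rewrite (vorth _ _ jk) mulr0.
exists (conv_hull (cross_vertices V)); split; first exact: cross_labeled WV n0.
split.
- split.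
    move=> x /enorm_eq1 x1; apply/(crossE WV n0).
    (* With [b = |v_k|^-2] and [c = dotv x v_k], the bound [b |c| <= (b c^2 + b) / 2] comes from
       [b (|c| - 1)^2 >= 0]. Both [\sum b c^2 = |x|^2] and [\sum b] are 1, so the total is at most
       1. *)
    have : \sum_k `|dotv (col k W) x| <= \sum_k
        2^-1 * (dotv (col k W) x * dotv x (col k V) +
                (dotv (col k V) (col k V))^-1).
      apply: ler_sum => k _; rewrite wE dotvZl (dotvC x) normrM.
      rewrite dotvC; set c := dotv x _; set b := _^-1.
      have b0 : 0 <= b by rewrite invr_ge0 dotv_ge0.
      have c2 : c * c = `|c| * `|c|.
        by rewrite -normrM ger0_norm// -expr2 sqr_ge0.
      rewrite (ger0_norm b0) -mulrA c2.
      have := mulr_ge0 b0 (sqr_ge0 (`|c| - 1)).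
      by lra.
    move/le_trans; apply.
    rewrite -mulr_sumr big_split /= -(dotv_dual WV) x1 vsum.
    by lra.
  apply: conv_hull_mono => x [k [->|->]]; first exact: vA.
  by rewrite /ellipsoid /= mulmxN dotvNl dotvNr opprK; exact: vA.
- move=> x; rewrite -[vertex _ x]/([set x | vertex _ x] x).
  rewrite (cross_verticesE WV) => -[k [->|->]]; first exact: vA.
  by rewrite /ellipsoid /= mulmxN dotvNl dotvNr opprK; exact: vA.
- move=> F /(facet_sign WV n0)[x xs ->].
  apply/(sign_facet_tangent WV xs); split.
    (* For a sign vector both [dotv x x] and the l1 norm of its coordinates reduce to
       [\sum_k |v_k|^-2 = 1], so [x] is a unit vector lying in the polytope. *)
    rewrite (dotv_dual WV) -[RHS]vsum; apply: eq_bigr => k _.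
    by rewrite wE dotvZl (dotvC (col k V)) -mulrA sign_vector_sqr// mulr1.
  apply/(crossE WV n0); rewrite -[leRHS]vsum; apply: ler_sum => k _.
  rewrite wE dotvZl normrM dotvC xs mulr1 ger0_norm// invr_ge0.
  exact: dotv_ge0.
Qed.

End TightCrossPolytopes.

(** * Column normalizations and the trace identity *)

Section Normalization.
Context {R : realType} {n : nat}.
Implicit Types (A B V W Q : 'M[R]_n).

Lemma sqr_enorm (x : 'cV[R]_n) : enorm x ^+ 2 = dotv x x.
Proof. by rewrite sqr_sqrtr // dotv_ge0. Qed.

Lemma enormZ (a : R) (x : 'cV[R]_n) : 0 <= a -> enorm (a *: x) = a * enorm x.
Proof.
move=> a0; rewrite /enorm dotvZl dotvZr mulrA -expr2 sqrtrM ?sqr_ge0//.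
by rewrite sqrtr_sqr ger0_norm.
Qed.

Lemma col_scale_columns B V k :
  col k (scale_columns B V) = (enorm (B *m col k V))^-1 *: col k V.
Proof. by apply/colP => i; rewrite !mxE mulrC. Qed.

Lemma scale_columns_ray B V (c : 'I_n -> R) k : 0 < c k ->
  forall U : 'M[R]_n, col k U = c k *: col k V ->
  col k (scale_columns B U) = col k (scale_columns B V).
Proof.
move=> c0 U UV; rewrite !col_scale_columns UV -scalemxAr enormZ ?ltW//.
by rewrite scalerA invfM mulrAC mulVf ?gt_eqF// mul1r.
Qed.

Lemma scale_columns_id B V : (forall k, ellipsoid B (col k V)) ->
  scale_columns B V = V.
Proof.
move=> BV; apply/matrixP => i k; rewrite mxE.
by have /enorm_eq1 -> := BV k; rewrite divr1.
Qed.

(** Scaling is invariant under positive multiples of each column, so only the outer normalization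
    survives. This makes the scalings by [A] and by the identity inverse to each other on suitably
    normalized matrices. *)
Lemma scale_columnsK A B V : (forall k, 0 < enorm (A *m col k V)) ->
  scale_columns B (scale_columns A V) = scale_columns B V.
Proof.
move=> AV; apply/matrixP => i k.
have := @scale_columns_ray B V (fun k => (enorm (A *m col k V))^-1) k.
rewrite invr_gt0 => /(_ (AV k) _ (col_scale_columns A V k)) /colP/(_ i).
by rewrite !mxE.
Qed.

(** The sum is the trace of [Q^T A^2 Q], and the trace is cyclic. *)
Lemma trace_orthogonal A Q : A^T = A -> orthogonal_group Q ->
  \sum_k dotv (A *m col k Q) (A *m col k Q) = \tr (A *m A).
Proof.
move=> AT QQ; rewrite -[A *m A]mulmx1 -(mulmx1C QQ) mulmxA mxtrace_mulC.
have -> : Q^T *m (A *m A *m Q) = (A *m Q)^T *m (A *m Q).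
  by rewrite trmx_mul AT !mulmxA.
by apply: eq_bigr => k _; rewrite gramE !colE !mulmxA.
Qed.

Lemma sym_posdef_unitmx A : sym_posdef A -> A \in unitmx.
Proof.
move=> [AT Apos]; rewrite unitmxE unitfE; apply/negP => /det0P[u u0 uA].
have /Apos : u^T != 0 by rewrite -trmx0 (inj_eq (@trmx_inj _ _ _)).
by rewrite -AT -trmx_mul uA trmx0 dotv0r ltxx.
Qed.

Lemma image_invmx_sphere A : A \in unitmx ->
  (fun x => invmx A *m x) @` unit_sphere = ellipsoid A.
Proof.
move=> uA; apply/seteqP; split=> [_ [x /enorm_eq1 x1 <-]|x Ax] /=.
  by rewrite /ellipsoid /= mulKVmx.
by exists (A *m x); rewrite ?mulKmx//; exact/enorm_eq1.
Qed.

Lemma regular_columnsE B V : B \in unitmx ->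
  (forall k, col k V != 0) -> regular_columns B V.
Proof.
move=> uB V0 k; rewrite dotv_gt0; apply: contra_neq (V0 k) => BV.
by rewrite -(mulKmx uB (col k V)) BV mulmx0.
Qed.

End Normalization.

Theorem corollary1p1 (R : realType) (n : nat) (n_ge1 : (1 <= n)%N)
    (A : 'M[R]_n) (Ein Eout : set 'cV[R]_n)
    (A_spd : sym_posdef A)
    (Ein_def : Ein = unit_sphere)
    (Eout_def : Eout = (fun x => invmx A *m x) @` Ein)
    (disj : Ein `&` Eout = set0)
    (Ein_sub : Ein `<=` conv_hull Eout) :
  (tight_cross_polytopes Eout !=set0 <-> \tr (A *m A) = 1) /\
  (tight_cross_polytopes Eout !=set0 ->
     diffeomorphism (tight_cross_polytopes Eout) (@orthogonal_group R n)
       normalize_columns).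
Proof.
have uA := sym_posdef_unitmx A_spd; have AT := A_spd.1.
have EE : Eout = ellipsoid A by rewrite Eout_def Ein_def image_invmx_sphere.
rewrite {Ein Eout Ein_def Eout_def disj Ein_sub}EE normalize_columnsE.
(* From here on only matrix identities on labels are needed. *)
have tightE V : tight_cross_polytopes (ellipsoid A) V <-> orthogonal_tight A V.
  by split; [exact: tight_orthogonal|exact: orthogonal_tight_tight].
have regular (B Q : 'M[R]_n) : B \in unitmx -> orthogonal_group Q ->
    regular_columns B Q.
  move=> uB QQ; apply: regular_columnsE => // k.
  by rewrite -dotv_eq0 -gramE QQ mxE eqxx oner_eq0.
have tight_regular V : orthogonal_tight A V -> regular_columns 1%:M V.
  move=> [_ _ VA]; apply: regular_columnsE => [|k]; first exact: unitmx1.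
  apply: contra_eq_neq (VA k) => ->.
  by rewrite mulmx0 dotv0r eq_sym oner_eq0.
have enorm_gt0 (B : 'M[R]_n) V : regular_columns B V ->
    forall k, 0 < enorm (B *m col k V) by move=> BV k; rewrite sqrtr_gt0.
have normal V : orthogonal_tight A V -> orthogonal_group (scale_columns 1%:M V).
  move=> VA; have [vorth _ _] := VA.
  apply/matrixP => j k; rewrite gramE !col_scale_columns dotvZl dotvZr mxE.
  case: (eqVneq j k) => [<-|jk]; last by rewrite vorth// !mulr0.
  have := enorm_gt0 _ _ (tight_regular _ VA) j; rewrite mul1mx => vj.
  by rewrite -sqr_enorm expr2 mulKf ?mulVf ?gt_eqF.
have normK V : orthogonal_tight A V ->
    scale_columns A (scale_columns 1%:M V) = V.
  move=> VA; rewrite scale_columnsK; last exact/enorm_gt0/tight_regular.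
  by apply: scale_columns_id; case: VA.
have traceA V : orthogonal_tight A V -> \tr (A *m A) = 1.
  move=> VA; rewrite -(trace_orthogonal AT (normal _ VA)).
  have [_ vsum vA] := VA; rewrite -[RHS]vsum; apply: eq_bigr => k _.
  rewrite col_scale_columns -scalemxAr dotvZl dotvZr vA mulr1 mul1mx.
  by rewrite -invfM -expr2 sqr_enorm.
(* The columns [q_k / |A q_k|] have inverse squared norms [|A q_k|^2], which sum to the trace. *)
have inverse Q : \tr (A *m A) = 1 -> orthogonal_group Q ->
    orthogonal_tight A (scale_columns A Q).
  move=> trA QQ; have AQ := enorm_gt0 _ _ (regular _ _ uA QQ).
  split=> [j k jk||k].
  - rewrite !col_scale_columns dotvZl dotvZr -gramE QQ mxE (negbTE jk).
    by rewrite !mulr0.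
  - rewrite -[RHS]trA -(trace_orthogonal AT QQ); apply: eq_bigr => k _.
    rewrite col_scale_columns dotvZl dotvZr -gramE QQ mxE eqxx mulr1.
    by rewrite -invfM invrK -expr2 sqr_enorm.
  - apply/enorm_eq1; rewrite col_scale_columns -scalemxAr enormZ.
      by rewrite mulVf// gt_eqF.
    by rewrite invr_ge0 ltW.
have orth1 : orthogonal_group (1%:M : 'M[R]_n).
  by rewrite /orthogonal_group /= trmx1 mulmx1.
split.
  split=> [[V /tightE /traceA]//|trA].
  (* Any orthogonal matrix would give a tight cross polytope; the identity is chosen. *)
  by exists (scale_columns A 1%:M); apply/tightE/inverse.
move=> [V0 /tightE /traceA trA]; split.
- split.
  + by move=> V /tightE /normal.
  + move=> V V' /set_mem/tightE VA /set_mem/tightE VA' VV'.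
    by rewrite -(normK _ VA) VV' normK.
  + move=> Q QQ; exists (scale_columns A Q); first exact/tightE/inverse.
    rewrite scale_columnsK; last exact/enorm_gt0/regular.
    apply: scale_columns_id => k.
    by rewrite /ellipsoid /= mul1mx -gramE QQ mxE eqxx.
(* The same formula extends the map smoothly to an open set of matrices, here and for the inverse
   below. *)
- move=> V /tightE VA; exists (regular_columns 1%:M), (scale_columns 1%:M).
  split=> //; [exact: open_regular_columns|exact: tight_regular
    |exact: scale_columns_smooth].
- exists (scale_columns A); split; first by move=> V /tightE /normK.
  move=> Q QQ; exists (regular_columns A), (scale_columns A).
  split=> //; [exact: open_regular_columns|exact: regular
    |exact: scale_columns_smooth].
Qed.
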